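(* For every $\varepsilon>0$ there exists a constant $C=C(\varepsilon)>0$ such that asymptotically almost every graph $H$ on $n$ vertices with $\lceil Cn\log n\rceil$ edges satisfies $f_\ell(H)\ge(2-\varepsilon)n$; that is, if $H$ is drawn uniformly at random from all graphs on vertex set $\{1,\dots,n\}$ with exactly $\lceil Cn\log n\rceil$ edges, then the probability that $f_\ell(H)\ge (2-\varepsilon)n$ tends to $1$ as $n\to\infty$.
   Context: All graphs are finite, without loops or parallel edges. For a graph $H$, $f_\ell(H)$ denotes the maximum list chromatic number $\chi_\ell(G)$ over all graphs $G$ that do not contain $H$ as a minor. $\log$ denotes the natural logarithm. *)

(* Defs.v *)
From HB Require Import structures.
From mathcomp Require Import all_boot all_order all_algebra finmap.
From mathcomp Require Import all_classical all_reals all_analysis.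

Set Implicit Arguments.
Unset Strict Implicit.
Unset Printing Implicit Defensive.

Import Order.TTheory GRing.Theory Num.Theory.

Local Open Scope ring_scope.

Record sgraph := SGraph {
  vertex :> finType;
  adj : rel vertex;
  adj_sym : symmetric adj;
  adj_irr : irreflexive adj }.

(* The induced subgraph on S is connected; the empty set qualifies, so
   nonemptiness is required separately of branch sets. *)
Definition connected_in (G : sgraph) (S : {set G}) : Prop :=
  {in S &, forall x y : G,
    connect [rel a b : G | [&& a \in S, b \in S & adj a b]] x y}.

Definition has_minor (H G : sgraph) : Prop :=
  exists B : H -> {set G},
    [/\ forall u, B u != finset.set0,
        forall u, connected_in (B u),
        forall u v, u != v -> [disjoint B u & B v] &
        forall u v, adj u v ->
          exists x y, [/\ x \in B u, y \in B v & adj x y]].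

Definition list_colorable (G : sgraph) (L : G -> {fset nat}) : Prop :=
  exists c : G -> nat,
    (forall v, c v \in L v) /\ (forall u v, adj u v -> c u != c v).

Definition choosable (G : sgraph) (k : nat) : Prop :=
  forall L : G -> {fset nat},
    (forall v, (k <= #|` L v|)%N) -> list_colorable L.

Lemma choosable_card (G : sgraph) : choosable G #|G|.
Proof.
move=> L hL.
suff [c [cL cI]] : exists c : G -> nat, (forall v, v \in enum G -> c v \in L v)
    /\ {in enum G &, injective c}.
  exists c; split=> [v|u v uv]; first by apply: cL; rewrite mem_enum.
  apply/eqP => /cI; rewrite !mem_enum => /(_ isT isT) e.
  by rewrite e adj_irr in uv.
have: (size (enum G) <= #|G|)%N by rewrite cardE.
elim: (enum G) (enum_uniq G) => [|x s IH] /= us sz.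
  by exists (fun=> 0%N); split.
have /andP[xs /IH/(_ (ltnW sz))[c [cL cI]]] := us.
have [a aL ac] : exists2 a, a \in L x & a \notin map c s.
  apply: contrapT => na.
  have : (#|` L x| <= size (map c s))%N.
    apply: uniq_leq_size (fset_uniq _) _ => a aL; apply/negPn/negP => nb.
    by apply: na; exists a.
  by rewrite size_map => /(leq_trans (hL x)) /(leq_trans sz); rewrite ltnn.
exists (fun v => if v == x then a else c v); split=> [v|u v].
  by rewrite inE; case: eqVneq => [->|_] //=; apply: cL.
rewrite !inE; case: (eqVneq u x) => [->|_]; case: (eqVneq v x) => [->|_] //=.
- by move=> _ vs e; rewrite e map_f in ac.
- by move=> us' _ e; rewrite -e map_f in ac.
- exact: cI.
Qed.

Lemma choosable_ex (G : sgraph) : exists k, `[< choosable G k >].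
Proof. by exists #|G|; apply/asboolP/choosable_card. Qed.

Definition list_chi (G : sgraph) : nat := ex_minn (choosable_ex G).

(* The maximum is rendered as a supremum in the extended reals, which is total:
   it agrees with the maximum as soon as the latter exists (f_ell_max). *)
Definition f_ell (R : realType) (H : sgraph) : \bar R :=
  ereal_sup [set x | exists2 G : sgraph,
    ~ has_minor H G & x = ((list_chi G)%:R)%:E]%classic.

Lemma f_ell_max (R : realType) (H G : sgraph) :
  ~ has_minor H G ->
  (forall G', ~ has_minor H G' -> (list_chi G' <= list_chi G)%N) ->
  f_ell R H = ((list_chi G)%:R)%:E.
Proof.
move=> HG maxG; apply/eqP; rewrite eq_le; apply/andP; split.
  by apply: ge_ereal_sup => _ [G' HG' ->]; rewrite lee_fin ler_nat maxG.
by apply: ereal_sup_ubound; exists G.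
Qed.

Definition edge_adj (n : nat) (E : {set {set 'I_n}}) : rel 'I_n :=
  [rel x y | (x != y) && ([set x; y] \in E)].

Lemma edge_adj_sym n (E : {set {set 'I_n}}) : symmetric (edge_adj E).
Proof. by move=> x y; rewrite /edge_adj /= eq_sym finset.setUC. Qed.

Lemma edge_adj_irr n (E : {set {set 'I_n}}) : irreflexive (edge_adj E).
Proof. by move=> x; rewrite /edge_adj /= eqxx. Qed.

Definition graph_of_edges (n : nat) (E : {set {set 'I_n}}) : sgraph :=
  SGraph (@edge_adj_sym n E) (@edge_adj_irr n E).

Definition edge_sets (n m : nat) : {set {set {set 'I_n}}} :=
  [set E : {set {set 'I_n}} | [forall e in E, #|e| == 2] & #|E| == m].

(* Equals 0 when m > 'C(n, 2), i.e. when there is no such graph. *)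
Definition gnm_prob (R : realType) (n m : nat) (P : sgraph -> Prop) : R :=
  #|[set E in edge_sets n m | `[< P (graph_of_edges E) >]]|%:R
    / #|edge_sets n m|%:R.

(* Main.v *)
Require Import Defs.
From mathcomp Require Import all_boot all_order all_algebra finmap zify ring lra.
From mathcomp Require Import all_classical all_reals all_analysis.
(* Last, so that the names shared with classical_sets denote finite sets. *)
From mathcomp Require Import fintype finset.

Set Implicit Arguments.
Unset Strict Implicit.
Unset Printing Implicit Defensive.

Import Order.TTheory GRing.Theory Num.Theory.
Import numFieldNormedType.Exports.

(* Let [m] be slightly smaller than [n].  Take a clique [A] on [m] vertices and,
   for every colouring [c] of [A] with [2m - 1] colours, a copy [B_c] of a clique
   [B] on [m] vertices; join [a] to [b] in every copy unless [F a b], where [F]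
   is a bipartite pattern of non-edges in which every [b] has at most [m / q]
   neighbours.  If all lists are [0 .. 2m - 2], except that [b] in [B_c] loses
   the colours [c a] with [F a b], then a colouring extending [c] is injective on
   [A] and [B_c], which is impossible; so the list chromatic number is at least
   [2m - m / q].

   Suppose that [H], in which any two disjoint sets of [d] vertices (a small
   fraction of [n]) span at least [L] edges, is a minor of this graph.  At most
   [m] branch sets meet [A]; density of [H] forces nearly all the others into a
   single [B_c], and then linearly many branch sets live in [B_c] and linearly
   many meet [A] but avoid [B_c].  After discarding the branch sets with more
   than [k] vertices there, each of the [L] edges of [H] between them asks for an
   edge between disjoint small subsets of [A] and [B].  A random [F] contains
   all the pairs between two such subsets with probability [q ^ - (k ^ 2)],
   independently for distinct edges of [H], so a union bound over
   [exp (O (n log n))] configurations produces an [F] that excludes the minor as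
   soon as [L] is a large multiple of [n log n].  Finally, a random [H] has this
   density with high probability by a Chernoff bound. *)

(** * Random non-edge patterns *)

(* Overwriting [g] by [tau] on [Q i] keeps [g] avoiding on the other blocks and
   is at most [q ^ k] to one, so avoiding one more block costs a factor of
   [1 - q ^ - k]. *)
Lemma card_avoid_patterns (T : finType) (q k : nat) (tau : {ffun T -> 'I_q})
    (I : eqType) (s : seq I) (Q : I -> {set T}) :
  0 < q -> uniq s -> {in s &, forall i j, i != j -> [disjoint Q i & Q j]} ->
  {in s, forall i, #|Q i| <= k} ->
  #|[set g : {ffun T -> 'I_q} |
      all (fun i => ~~ [forall x in Q i, g x == tau x]) s]| * (q ^ k) ^ size s
    <= q ^ #|T| * (q ^ k - 1) ^ size s.
Proof.
move=> q0; elim: s => [|i s IH] /=; first by move=> *; rewrite !muln1 (leq_trans (max_card _)) // card_ffun card_ord.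
case/andP=> iNs us dQ kQ.
set Ns := [set g | _ & _].
have {}IH := IH us (sub_in2 (fun x xs => mem_behead (s := i :: s) xs) dQ)
  (sub_in1 (fun x xs => mem_behead (s := i :: s) xs) kQ).
set N := #|[set g | all _ s]| in IH.
set A := [set g : {ffun T -> 'I_q} | all _ s] in N IH.
set M := A :&: [set g : {ffun T -> 'I_q} | [forall x in Q i, g x == tau x]].
have NsM : #|Ns| + #|M| = N.
  rewrite /N -(cardsID [set g : {ffun T -> 'I_q} | [forall x in Q i, g x == tau x]] A).
  rewrite addnC; congr (_ + _); apply: eq_card => g; rewrite !inE andbC; by [].
have leN : N <= #|M| * q ^ k.
  (* The second component stores the overwritten values, so [h] is injective, and it takes at most
     [q ^ k] values. *)
  pose h (g : {ffun T -> 'I_q}) :=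
    ([ffun x => if x \in Q i then tau x else g x],
     [ffun x : {x | x \in Q i} => g (val x)]).
  have hinj : injective h.
    move=> g1 g2 [/ffunP e1 /ffunP e2]; apply/ffunP => x.
    case: (boolP (x \in Q i)) => xQ; first by have := e2 (exist _ x xQ); rewrite !ffunE.
    by have := e1 x; rewrite !ffunE (negbTE xQ).
  rewrite /N -(card_imset _ hinj).
  apply: (@leq_trans #|setX M [set: {ffun {x | x \in Q i} -> 'I_q}]|).
    apply: subset_leq_card; apply/subsetP => _ /imsetP[g gA ->].
    rewrite !inE /= andbT; apply/andP; split; last first.
      by apply/forall_inP => x xQ; rewrite ffunE xQ.
    apply/allP => j js; move: gA; rewrite inE => /allP/(_ j js).
    apply: contra => /forall_inP H; apply/forall_inP => x xQ.
    have := H x xQ; rewrite ffunE ifN //.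
    have ij : i != j by apply: contraNneq iNs => ->.
    have := dQ i j (mem_head _ _) _ ij; rewrite inE js orbT => /(_ isT) /pred0P/(_ x) /=.
    by rewrite xQ andbT => ->.
  rewrite cardsX cardsT card_ffun card_ord leq_mul2l; apply/orP; right.
  by rewrite card_sig leq_pexp2l //; apply: (kQ i (mem_head _ _)).
rewrite !expnS.
apply: (@leq_trans ((N * (q ^ k - 1)) * (q ^ k) ^ size s)).
  rewrite mulnA leq_mul2r; apply/orP; right.
  by rewrite mulnBr muln1 -NsM; move: leN; rewrite -NsM mulnDl; move: (#|Ns|) (#|M|) (q ^ k) => x y z; nia.
rewrite mulnAC [leqRHS]mulnCA [leqRHS]mulnC leq_mul2r; by apply/orP; right.
Qed.

Lemma leq_card_bigcup (I T : finType) (P : pred I) (A : I -> {set T}) :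
  #|\bigcup_(i | P i) A i| <= \sum_(i | P i) #|A i|.
Proof.
elim/big_rec2: _ => [|i n B _ IH]; first by rewrite cards0.
by rewrite (leq_trans (leq_card_setU _ _)) // leq_add2l.
Qed.

Lemma card_set_type (T : finType) : #|{: {set T}}| = 2 ^ #|T|.
Proof. by rewrite -(cardsT T) -card_powerset powersetT cardsT. Qed.

(** Codes small sets by [k]-tuples with repetitions, so that the union bound pays at most [m ^ k]
    for each branch set. *)
Lemma exists_tuple_image (T : finType) (k : nat) (X : {set T}) :
  X != set0 -> #|X| <= k -> exists f : {ffun 'I_k -> T}, f @: 'I_k = X.
Proof.
case/set0Pn=> x0 x0X Xk.
exists [ffun i : 'I_k => if i < #|X| then nth x0 (enum X) i else x0].
apply/setP => x; apply/imsetP/idP => [[i _ ->]|xX].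
  rewrite ffunE; case: ifP => // iX; by rewrite -mem_enum mem_nth // -cardE.
have ix : index x (enum X) < #|X| by rewrite cardE index_mem mem_enum.
exists (Ordinal (leq_trans ix Xk)) => //.
by rewrite ffunE /= ix nth_index // mem_enum.
Qed.

Lemma exists_rare_color (T : finType) (q : nat) (g : T -> 'I_q) :
  0 < q -> exists c, q * #|[set x | g x == c]| <= #|T|.
Proof.
case: q g => // q g _.
case: (arg_minnP (fun c => #|[set x | g x == c]|) (isT : xpredT (ord0 : 'I_q.+1))).
move=> c _ cmin; exists c.
have -> : #|T| = \sum_(c' < q.+1) #|[set x | g x == c']|.
  rewrite -sum1_card (partition_big g xpredT) //=.
  by apply: eq_bigr => c' _; rewrite -sum1_card; apply: eq_bigl => x; rewrite inE.
apply: (@leq_trans (\sum_(c' < q.+1) #|[set x | g x == c]|)).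
  by rewrite sum_nat_const card_ord.
by apply: leq_sum => c' _; apply: cmin.
Qed.

Definition edges_between (H : sgraph) (S T : {set H}) : {set H * H} :=
  [set uv in setX S T | adj uv.1 uv.2].

Definition small_disjoint (H : sgraph) (m k : nat) (S : {set H}) (X : H -> {set 'I_m}) :=
  [forall u in S, (X u != set0) && (#|X u| <= k)] &&
  [forall u in S, forall v in S, (u != v) ==> [disjoint X u & X v]].

(* The pattern is [F a b := (g (a, b) == t b)] for a random [g] and the rarest
   colour [t b] of column [b]; including [t] in the union bound is what makes the
   degree condition free. *)
Lemma exists_nonedge_pattern (H : sgraph) (m q k d N : nat) :
  0 < q -> 0 < m ->
  (forall S T : {set H}, [disjoint S & T] -> d <= #|S| -> d <= #|T| ->
     N <= #|edges_between S T|) ->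
  (m ^ k) ^ #|H| * (m ^ k) ^ #|H| * 2 ^ #|H| * 2 ^ #|H| * q ^ m *
    (q ^ (k * k) - 1) ^ N < (q ^ (k * k)) ^ N ->
  exists F : rel 'I_m, (forall b, q * #|[set a | F a b]| <= m) /\
    (forall (S T : {set H}) (X Y : H -> {set 'I_m}),
       [disjoint S & T] -> d <= #|S| -> d <= #|T| ->
       small_disjoint k S X -> small_disjoint k T Y ->
       exists u v, [/\ u \in S, v \in T, adj u v &
         forall a b, a \in X u -> b \in Y v -> F a b]).
Proof.
move=> q0 m0 HN num.
pose tup := {ffun H -> {ffun 'I_k -> 'I_m}}.
(* A configuration codes the two families of small sets, the index sets [S] and [T], and the column
   colours [t]. *)
pose cfg := (tup * tup * {set H} * {set H} * {ffun 'I_m -> 'I_q})%type.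
pose im (al : tup) u : {set 'I_m} := al u @: 'I_k.
pose blk (c : cfg) (uv : H * H) : {set 'I_m * 'I_m} :=
  setX (im c.1.1.1.1 uv.1) (im c.1.1.1.2 uv.2).
pose tau (c : cfg) : {ffun 'I_m * 'I_m -> 'I_q} := [ffun x => c.2 x.2].
pose valid (c : cfg) := [&& [disjoint c.1.1.2 & c.1.2], d <= #|c.1.1.2|,
  d <= #|c.1.2|, small_disjoint k c.1.1.2 (im c.1.1.1.1) & small_disjoint k c.1.2 (im c.1.1.1.2)].
pose bad (c : cfg) := [set g : {ffun 'I_m * 'I_m -> 'I_q} |
  [forall uv in edges_between c.1.1.2 c.1.2,
     ~~ [forall x in blk c uv, g x == tau c x]]].
have badN c : valid c -> #|bad c| * (q ^ (k * k)) ^ N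
    <= q ^ (m * m) * (q ^ (k * k) - 1) ^ N.
  case/and5P=> dST dS dT /andP[/forall_inP okS /forall_inP disS].
  case/andP=> /forall_inP okT /forall_inP disT.
  have leN := HN _ _ dST dS dT.
  (* Exactly [N] edges are kept, so the estimate has the same exponent for all configurations. *)
  pose s := take N (enum (edges_between c.1.1.2 c.1.2)).
  have sz : size s = N by rewrite size_takel // -cardE.
  have us : uniq s by rewrite take_uniq // enum_uniq.
  have se uv : uv \in s -> [/\ uv.1 \in c.1.1.2, uv.2 \in c.1.2 & adj uv.1 uv.2].
    by move/mem_take; rewrite mem_enum !inE => /andP[/andP[]].
  (* Distinct edges differ in an endpoint on one side, and the small sets on that side are disjoint;
     hence so are the blocks. *)
  have dis : {in s &, forall i j, i != j -> [disjoint blk c i & blk c j]}.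
    move=> [u v] [u' v'] /se[/= uS vT _] /se[/= u'S v'T _] ne.
    apply/pred0P => -[a b] /=; apply/negP => /andP[].
    rewrite !inE /= => /andP[au bv] /andP[au' bv'].
    case: (eqVneq u u') ne => [<-|nu _].
      rewrite xpair_eqE eqxx /= => nv.
      have /forall_inP/(_ _ v'T)/implyP/(_ nv)/pred0P/(_ b) := disT _ vT.
      by rewrite /= bv bv'.
    have /forall_inP/(_ _ u'S)/implyP/(_ nu)/pred0P/(_ a) := disS _ uS.
    by rewrite /= au au'.
  have szb : {in s, forall i, #|blk c i| <= k * k}.
    move=> uv /se[uS vT _]; rewrite cardsX.
    have /andP[_ h1] := okS _ uS; have /andP[_ h2] := okT _ vT; exact: leq_mul.
  have := card_avoid_patterns (tau c) q0 us dis szb.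
  rewrite sz card_prod !card_ord; apply: leq_trans.
  rewrite leq_mul2r; apply/orP; right; apply: subset_leq_card.
  apply/subsetP => g; rewrite !inE => /forall_inP hg; apply/allP => uv uvs.
  by apply: hg; have := mem_take uvs; rewrite mem_enum.
pose U := \bigcup_(c | valid c) bad c.
have cU : #|U| < q ^ (m * m).
  have Q0 : 0 < (q ^ (k * k)) ^ N by rewrite !expn_gt0 q0.
  rewrite -(ltn_pmul2r Q0).
  apply: (@leq_ltn_trans (\sum_(c | valid c) #|bad c| * (q ^ (k * k)) ^ N)).
    rewrite -big_distrl /= leq_mul2r; apply/orP; right.
    exact: leq_card_bigcup.
  apply: (@leq_ltn_trans (\sum_(c : cfg) q ^ (m * m) * (q ^ (k * k) - 1) ^ N)).
    rewrite [leqRHS](bigID valid) /= -[leqLHS]addn0; apply: leq_add => //.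
    exact: leq_sum.
  rewrite sum_nat_const !card_prod !card_ffun !card_ord !card_set_type mulnCA ltn_pmul2l //.
  by rewrite expn_gt0 q0.
have [g gU] : exists g : {ffun 'I_m * 'I_m -> 'I_q}, g \notin U.
  apply/existsP; rewrite -negb_forall; apply: contraTN cU => /forallP hU.
  have <- : #|{ffun 'I_m * 'I_m -> 'I_q}| = q ^ (m * m).
    by rewrite card_ffun card_prod !card_ord.
  rewrite -leqNgt -cardsT; apply: subset_leq_card.
  by apply/subsetP => g _; apply: hU.
have [t ht] : exists t : {ffun 'I_m -> 'I_q},
    forall b, q * #|[set a | g (a, b) == t b]| <= m.
  have h b := exists_rare_color (fun a => g (a, b)) q0.
  exists [ffun b => xchoose (h b)] => b.
  by rewrite ffunE (leq_trans (xchooseP (h b))) // card_ord.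
exists (fun a b => g (a, b) == t b); split=> // S T X Y dST dS dT okX okY.
have enc (S' : {set H}) (X' : H -> {set 'I_m}) : small_disjoint k S' X' ->
    exists al : tup, {in S', forall u, im al u = X' u}.
  case/andP=> /forall_inP ok _.
  have h u : exists f : {ffun 'I_k -> 'I_m}, (u \in S') ==> (f @: 'I_k == X' u).
    case: (boolP (u \in S')) => /= [uS|_]; last by exists [ffun=> Ordinal m0].
    have /andP[x1 x2] := ok _ uS.
    by have [f fE] := exists_tuple_image x1 x2; exists f; rewrite fE.
  exists [ffun u => xchoose (h u)] => u uS; rewrite /im ffunE.
  by have /implyP/(_ uS)/eqP := xchooseP (h u).
have ok_eq (S' : {set H}) (X1 X2 : H -> {set 'I_m}) : {in S', X1 =1 X2} ->
    small_disjoint k S' X2 -> small_disjoint k S' X1.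
  move=> e /andP[/forall_inP h1 /forall_inP h2]; apply/andP; split.
    by apply/forall_inP => u uS; rewrite e // h1.
  apply/forall_inP => u uS; apply/forall_inP => v vS; rewrite !e //.
  by have /forall_inP := h2 _ uS; apply.
have [al hal] := enc _ _ okX; have [be hbe] := enc _ _ okY.
pose c : cfg := (al, be, S, T, t).
have vc : valid c by rewrite /valid /= dST dS dT (ok_eq _ _ _ hal) // (ok_eq _ _ _ hbe).
have : g \notin bad c by apply: contra gU => gb; apply/bigcupP; exists c.
rewrite inE negb_forall => /existsP[[u v]].
rewrite negb_imply negbK !inE /= => /andP[/andP[/andP[uS vT] uv] /forall_inP hx].
exists u, v; split=> // a b aX bY; have := hx (a, b).
by rewrite ffunE /=; apply; rewrite !inE /= hal // hbe // aX.
Qed.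

(** * The pasted graph: excluded minors and list chromatic number *)

Definition pasted_adj (m : nat) (I : finType) (F : rel 'I_m)
    (x y : 'I_m + I * 'I_m) : bool :=
  match x, y with
  | inl a, inl a' => a != a'
  | inl a, inr p => ~~ F a p.2
  | inr p, inl a => ~~ F a p.2
  | inr p, inr p' => (p.1 == p'.1) && (p.2 != p'.2)
  end.

Lemma pasted_adj_sym m I F : symmetric (@pasted_adj m I F).
Proof. by case=> [a|p] [a'|p'] //=; rewrite eq_sym // [p.2 == _]eq_sym. Qed.

Lemma pasted_adj_irr m I F : irreflexive (@pasted_adj m I F).
Proof. by case=> [a|p] /=; rewrite ?eqxx ?andbF. Qed.

Definition pasted (m : nat) (I : finType) (F : rel 'I_m) : sgraph :=
  SGraph (@pasted_adj_sym m I F) (@pasted_adj_irr m I F).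

(** Double counting: each [x] lies in at most one [X u]. *)
Lemma sum_card_disjoint (J T : finType) (S : {set J}) (X : J -> {set T}) :
  (forall u v, u != v -> [disjoint X u & X v]) ->
  \sum_(u in S) #|X u| <= #|T|.
Proof.
move=> dX.
rewrite (eq_bigr (fun u => \sum_(x : T) (x \in X u : nat))); last first.
  by move=> u _; rewrite -sum1_card big_mkcond.
rewrite exchange_big /= -sum1_card; apply: leq_sum => x _.
case: (pickP (fun u => (u \in S) && (x \in X u))) => [u /andP[uS xu]|no].
  rewrite (bigD1 u) //= big1 ?xu // => v /andP[_ vu].
  by have /pred0P/(_ x) := dX _ _ vu; rewrite /= xu andbT => ->.
by rewrite big1 // => u uS; have := no u; rewrite /= uS /= => ->.
Qed.

Lemma card_nonempty_disjoint (J T : finType) (X : J -> {set T}) :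
  (forall u v, u != v -> [disjoint X u & X v]) ->
  #|[set u | X u != set0]| <= #|T|.
Proof.
move=> dX; apply: leq_trans (sum_card_disjoint [set u | X u != set0] dX).
by rewrite -sum1_card; apply: leq_sum => u; rewrite inE card_gt0.
Qed.

Lemma card_large_disjoint (J T : finType) (k d : nat) (X : J -> {set T}) :
  (forall u v, u != v -> [disjoint X u & X v]) -> #|T| < k.+1 * d.+1 ->
  #|[set u | k < #|X u|]| <= d.
Proof.
move=> dX Tkd; rewrite -ltnS -(ltn_pmul2l (ltn0Sn k)); apply: leq_ltn_trans Tkd.
apply: leq_trans (sum_card_disjoint [set u | k < #|X u|] dX).
rewrite mulnC -sum_nat_const; apply: leq_sum => u; by rewrite inE.
Qed.

(** The surplus [3 * d] is spent in three portions: fewer than [d] branch sets missing the clique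
    lie outside the main copy, at most [d] are discarded as too large, and [d] must survive on each
    side. *)
Lemma pasted_minor_free (H : sgraph) (m k d : nat) (I : finType) (F : rel 'I_m) :
  m + 3 * d <= #|H| -> m < k.+1 * d.+1 ->
  (forall S T : {set H}, [disjoint S & T] -> d <= #|S| -> d <= #|T| ->
     exists u v, [/\ u \in S, v \in T & adj u v]) ->
  (forall (S T : {set H}) (X Y : H -> {set 'I_m}),
     [disjoint S & T] -> d <= #|S| -> d <= #|T| ->
     small_disjoint k S X -> small_disjoint k T Y ->
     exists u v, [/\ u \in S, v \in T, adj u v &
       forall a b, a \in X u -> b \in Y v -> F a b]) ->
  ~ has_minor H (pasted I F).
Proof.
move=> mH mk edg pat [B [B0 Bc Bd Be]].
(* For [d = 0], [edg] would find a vertex in the empty set. *)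
have d0 : 0 < d.
  rewrite lt0n; apply/eqP => dE; rewrite dE in edg.
  by have [|u [v [/[!inE]]]] := edg set0 set0 _ (leq0n _) (leq0n _); rewrite -?setI_eq0 ?set0I.
pose X u : {set 'I_m} := [set a | (inl a : pasted I F) \in B u].
pose Y i u : {set 'I_m} := [set b | (inr (i, b) : pasted I F) \in B u].
have dX u v : u != v -> [disjoint X u & X v].
  move=> /Bd/pred0P h; apply/pred0P => a; have := h (inl a); by rewrite /= !inE.
have dY i u v : u != v -> [disjoint Y i u & Y i v].
  move=> /Bd/pred0P h; apply/pred0P => a; have := h (inr (i, a)); by rewrite /= !inE.
(* The branch sets that miss the clique. *)
pose U := [set u | X u == set0].
have cU : #|~: U| <= m.
  have := card_nonempty_disjoint dX; rewrite card_ord; apply: leq_trans.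
  by apply: eq_leq; apply: eq_card => u; rewrite !inE.
have cUU : #|U| + #|~: U| = #|H| by rewrite cardsC.
have UX u a : u \in U -> (inl a : pasted I F) \notin B u.
  by rewrite inE => /eqP/setP/(_ a); rewrite !inE => ->.
(* Distinct copies are connected only through the clique, so a branch set missing it stays in one
   copy. *)
have Ucls u : u \in U -> exists i, forall x, x \in B u -> exists b, x = inr (i, b).
  move=> uU; have /set0Pn[[a|[i b]] xB] := B0 u; first by rewrite (negbTE (UX _ _ uU)) in xB.
  exists i => y yB; have := Bc u _ _ xB yB.
  case/connectP=> p; elim: p b {xB} => [|z p IH] b /=; first by move=> _ ->; exists b.
  case/andP=> /and3P[_ zB]; case: z zB => [a|[i' b']] zB.
    by rewrite (negbTE (UX _ _ uU)) in zB.
  by case/andP=> /= /eqP <- _; apply: IH.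
have Uuniq u i j : u \in U -> Y i u != set0 -> Y j u != set0 -> i = j.
  move=> /Ucls[i' h] /set0Pn[b] /[!inE]/h[b1 [-> _]].
  by case/set0Pn=> b2 /[!inE] /h[b3 []].
have Uadj u v i : u \in U -> v \in U -> adj u v -> Y i u != set0 -> Y i v != set0.
  move=> uU vU /Be[x [y [xu yv xy]]] Yi.
  have [i1 /(_ _ xu)[b xE]] := Ucls _ uU; have [i2 /(_ _ yv)[b' yE]] := Ucls _ vU.
  rewrite {}xE {}yE in xu yv xy; case/andP: xy => /= /eqP e _.
  have -> : i = i1 by apply: (Uuniq u) => //; apply/set0Pn; exists b; rewrite inE.
  by rewrite e; apply/set0Pn; exists b'; rewrite inE.
pose cls (J : {set I}) := [set u in U | [exists i in J, Y i u != set0]].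
(* No edge of [H] joins [cls J] to the rest of [U], so [edg] forbids both from being large. *)
have dich J : (#|cls J| < d) || (#|U :\: cls J| < d).
  case: ltnP => //= h1; case: ltnP => // h2.
  have [|u [v [uc vc uv]]] := edg (cls J) (U :\: cls J) _ h1 h2.
    by apply/pred0P => u /=; rewrite in_setD; case: (u \in cls J).
  move: vc; rewrite in_setD => /andP[/negP nvc vU]; case: nvc.
  move: uc; rewrite ![_ \in cls _]inE vU => /andP[uU /existsP[i /andP[iJ Yi]]].
  by apply/existsP; exists i; rewrite iJ (Uadj _ _ _ uU vU uv).
have U3 : 3 * d <= #|U| by lia.
have clsT : cls setT = U.
  apply/setP => u; rewrite inE; case: (boolP (u \in U)) => //= uU.
  have [i h] := Ucls _ uU; have /set0Pn[x xB] := B0 u; have [b xE] := h _ xB.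
  by apply/existsP; exists i; rewrite inE; apply/set0Pn; exists b; rewrite inE -xE.
have dT : d <= #|cls setT| by rewrite clsT; lia.
have cls_sub J : #|U :\: cls J| = #|U| - #|cls J|.
  rewrite cardsD (setIidPr _) //; by apply/subsetP => u; rewrite inE => /andP[].
(* Take a smallest [J] with [d <= #|cls J|] and [j] in it. If [cls [set j]] were small, then [cls J]
   would have fewer than [2 * d] elements and, by [dich], [U] fewer than [3 * d]. *)
have [j Wj] : exists j, #|U :\: cls [set j]| < d.
  case: (@arg_minnP _ setT (fun J => d <= #|cls J|) (fun J : {set I} => #|J|) dT) => J dJ Jmin.
  have /set0Pn[j jJ] : J != set0.
    apply: contraTneq dJ => ->; rewrite -ltnNge (_ : cls set0 = set0) ?cards0 //.
    apply/setP => u; rewrite !inE; apply/negP => /andP[_ /existsP[i]]; by rewrite inE.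
  exists j; have := dich [set j]; case/orP => // small.
  have Jj : #|cls (J :\ j)| < d.
    rewrite ltnNge; apply/negP => /Jmin; rewrite (cardsD1 j J) jJ; lia.
  have : #|cls J| <= #|cls (J :\ j)| + #|cls [set j]|.
    apply: leq_trans (leq_card_setU _ _).
    apply: subset_leq_card; apply/subsetP => u.
    rewrite !inE => /andP[-> /existsP[i /andP[iJ Yi]]] /=.
    case: (eqVneq i j) => [ij|nij]; apply/orP; [right|left]; apply/existsP; exists i.
      by rewrite inE ij eqxx -ij Yi.
    by rewrite !inE nij iJ.
  have := dich J; rewrite ltnNge dJ /= cls_sub; lia.
pose Z := [set u | Y j u != set0].
have cZ : #|Z| <= m by have := card_nonempty_disjoint (dY j); rewrite card_ord.
have clsE : cls [set j] = Z :&: U.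
  apply/setP => u; rewrite !inE andbC; congr (_ && _).
  apply/existsP/idP => [[i]|h]; first by rewrite inE => /andP[/eqP ->].
  by exists j; rewrite inE eqxx.
have Ydj : #|[set u | k < #|Y j u|]| <= d.
  by apply: (card_large_disjoint (dY j)); rewrite card_ord.
have Xd : #|[set u | k < #|X u|]| <= d.
  by apply: (card_large_disjoint dX); rewrite card_ord.
have c1 := cardsID U Z; have c2 := cardsID Z (~: U).
have ZU : Z :\: U = ~: U :&: Z by apply/setP => u; rewrite !inE.
rewrite cls_sub clsE in Wj; rewrite ZU in c1.
(* [S] gathers branch sets meeting the clique but not copy [j], [T] those inside copy [j]. Since
   [#|Z| <= m] and [Z :&: U] misses fewer than [d] elements of [U], more than
   [#|H| - m - d >= 2 * d] candidates exist for [S]. *)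
pose S := (~: U :\: Z) :\: [set u | k < #|X u|].
pose T := (Z :&: U) :\: [set u | k < #|Y j u|].
have leD (P Q : {set H}) : #|P| - #|Q| <= #|P :\: Q|.
  by rewrite cardsD leq_sub2l // subset_leq_card // subsetIr.
have dS : d <= #|S| by apply: leq_trans (leD _ _); lia.
have dT' : d <= #|T| by apply: leq_trans (leD _ _); lia.
have dST : [disjoint S & T].
  by apply/pred0P => u; rewrite !inE /=; case: (X u == set0); rewrite ?andbF.
have okS : small_disjoint k S X.
  apply/andP; split; apply/forall_inP => u; last first.
    by move=> _; apply/forall_inP => v _; apply/implyP/dX.
  by rewrite !inE -leqNgt => /and3P[-> _ ->].
have okT : small_disjoint k T (Y j).
  apply/andP; split; apply/forall_inP => u; last first.
    by move=> _; apply/forall_inP => v _; apply/implyP/dY.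
  by rewrite !inE -leqNgt => /and3P[-> -> _].
have [u [v [uS vT uv FXY]]] := pat S T X (Y j) dST dS dT' okS okT.
have [x [y [xu yv xy]]] := Be _ _ uv.
have vU : v \in U by move: vT; rewrite 2!inE => /andP[_ /setIP[]].
have vZ : Y j v != set0 by move: vT; rewrite !inE => /and3P[].
have uZ : Y j u == set0 by move: uS; rewrite !inE negbK => /and3P[].
have [i hv] := Ucls _ vU; have [b yE] := hv _ yv; rewrite {}yE in yv xy.
have ij : i = j by apply: (Uuniq v) => //; apply/set0Pn; exists b; rewrite inE.
(* The edge realising [uv] ends in copy [j]; its other end is either in the clique, where [F] makes
   the pair a non-edge, or in copy [j], which [B u] misses. *)
rewrite {}ij in yv xy; case: x xu xy => [a|[i' b']] xu /=.
  by rewrite FXY // inE.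
case/andP=> /= /eqP ij _; rewrite ij in xu.
by move/eqP/setP: uZ => /(_ b'); rewrite !inE xu.
Qed.

(** Diagonal argument: any list colouring meets the copy whose lists were designed against its own
    restriction to the clique, and there [2 * m] vertices would need distinct colours among
    [2 * m - 1]. *)
Lemma list_chi_pasted (m q : nat) (F : rel 'I_m) :
  0 < m -> 0 < q -> (forall b, q * #|[set a | F a b]| <= m) ->
  2 * m - m %/ q <= list_chi (pasted {ffun 'I_m -> 'I_(2 * m - 1)} F).
Proof.
move=> m0 q0 degF; rewrite /list_chi; case: ex_minnP => k /asboolP ch _.
rewrite leqNgt; apply/negP => klt.
have dF b : #|[set a | F a b]| <= m %/ q by rewrite leq_divRL // mulnC.
move: (m %/ q) dF klt => D dF klt.
set N := 2 * m - 1.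
pose forb (c : {ffun 'I_m -> 'I_N}) b := [seq val (c a) | a <- enum [set a | F a b]].
pose L (x : pasted {ffun 'I_m -> 'I_N} F) : {fset nat} :=
  match x with
  | inl _ => [fset i in iota 0 N]%fset
  | inr p => [fset i in [seq i <- iota 0 N | i \notin forb p.1 p.2]]%fset
  end.
have Lk v : k <= #|` L v|.
  case: v => [a|[c b]] /=; rewrite card_fseq undup_id ?filter_uniq ?iota_uniq //.
    by rewrite size_iota /N; lia.
  rewrite size_filter.
  have cnt : count (fun i => i \in forb c b) (iota 0 N)
      + count (fun i => i \notin forb c b) (iota 0 N) = N.
    by rewrite -[RHS](size_iota 0); apply: (count_predC (fun i => i \in forb c b)).
  have : count (fun i => i \in forb c b) (iota 0 N) <= D.
    rewrite -size_filter (leq_trans _ (dF b)) // cardE -(size_map (fun a => val (c a))).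
    apply: uniq_leq_size; first by rewrite filter_uniq // iota_uniq.
    by move=> i; rewrite mem_filter => /andP[].
  move: cnt; set x := count _ _; set y := count _ _.
  by rewrite /N; lia.
have [col [colL colA]] := ch L Lk.
have N0 : 0 < N by rewrite /N; lia.
(* The default of [insubd] never occurs, since the lists on the clique lie below [N]. *)
pose c : {ffun 'I_m -> 'I_N} := [ffun a => insubd (Ordinal N0) (col (inl a))].
have cE a : val (c a) = col (inl a).
  rewrite ffunE val_insubd; have := colL (inl a); rewrite /L in_fset mem_iota add0n.
  by case/andP => _ ->.
pose h (x : 'I_m + 'I_m) : nat :=
  match x with inl a => col (inl a) | inr b => col (inr (c, b)) end.
have hN x : h x \in iota 0 N.
  case: x => [a|b] /=; first by have := colL (inl a); rewrite /L in_fset.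
  by have := colL (inr (c, b)); rewrite /L in_fset mem_filter => /andP[].
(* Adjacency separates the colours unless [F a b], in which case the list at [b] omits the colour of
   [a]. *)
have hab a b : h (inl a) != h (inr b).
  case: (boolP (F a b)) => Fab; last by apply: colA.
  have := colL (inr (c, b)); rewrite /L in_fset mem_filter => /andP[+ _].
  apply: contraNneq => /= <-; apply/mapP; exists a; last by rewrite cE.
  by rewrite mem_enum inE.
have hinj : injective h.
  move=> [a|b] [a'|b'] e; apply/eqP.
  - by apply: contraPT e => ne; apply/eqP/colA.
  - by have := hab a b'; rewrite e eqxx.
  - by have := hab a' b; rewrite e eqxx.
  - by apply: contraPT e => ne; apply/eqP/colA; rewrite /= eqxx.
have : size (map h (enum {: 'I_m + 'I_m})) <= size (iota 0 N).
  apply: uniq_leq_size; first by rewrite map_inj_uniq ?enum_uniq.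
  by move=> _ /mapP[x _ ->].
by rewrite size_map -cardE card_sum !card_ord size_iota /N; lia.
Qed.

(** * Concentration for random edge sets *)

Local Open Scope ring_scope.

(** Double counting of pairs of a set and a marked element of it; this simulates drawing without
    replacement one element at a time. *)
Lemma sum_draws_succ (R : comNzRingType) (T : finType) (Om : {set T}) (M : nat)
    (f : {set T} -> R) :
  M.+1%:R * \sum_(E : {set T} | (E \subset Om) && (#|E| == M.+1)) f E =
  \sum_(E : {set T} | (E \subset Om) && (#|E| == M))
     \sum_(e in Om :\: E) f (e |: E).
Proof.
rewrite mulr_sumr.
rewrite (eq_bigr (fun E : {set T} => \sum_(e in E) f E)); last first.
  by move=> E /andP[_ /eqP cE]; rewrite sumr_const cE mulr_natl.
rewrite !pair_big_dep /=.
rewrite (reindex_onto (fun p : {set T} * T => (p.2 |: p.1, p.2))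
                      (fun p : {set T} * T => (p.1 :\ p.2, p.2))) /=; last first.
  by move=> [E e] /= /andP[_ eE]; rewrite setD1K.
apply: eq_bigl => -[E e] /=; rewrite xpair_eqE eqxx andbT setU11 andbT in_setD.
rewrite subUset sub1set cardsU1; case: (boolP (e \in E)) => eE /=.
  rewrite andbF; apply/negbTE/negP => /andP[_ /eqP EE].
  by move: eE; rewrite -EE !inE eqxx.
rewrite add1n eqSS setU1K // eqxx andbT.
by case: (e \in Om); rewrite ?andbT ?andbF.
Qed.

(* While at most [M0 <= p] elements are drawn, each new element hits [P] with
   conditional probability at least [(p - M0) / #|Om|], so it multiplies the
   moment by at most [1 - (p - M0) / (2 * #|Om|)]. *)
Lemma sum_draws_half (R : realFieldType) (T : finType) (Om P : {set T})
    (M M0 p : nat) :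
  P \subset Om -> (p <= #|P|)%N -> (M <= M0)%N -> (M0 <= p)%N ->
  \sum_(E : {set T} | (E \subset Om) && (#|E| == M)) (2^-1 : R) ^+ #|E :&: P|
    <= (1 - (p - M0)%:R / (2 * #|Om|%:R)) ^+ M * 'C(#|Om|, M)%:R.
Proof.
move=> PO pP; set c : R := (p - M0)%:R / (2 * #|Om|%:R).
have pO : (#|P| <= #|Om|)%N by apply: subset_leq_card.
have cO : c * #|Om|%:R <= (p - M0)%:R / 2.
  rewrite /c; case: (posnP #|Om|) => [->|O0]; first by rewrite mulr0 divr_ge0.
  by rewrite invfM mulrA mulfVK // pnatr_eq0 -lt0n.
have c0 : 0 <= c by rewrite /c divr_ge0 // mulr_ge0.
have c1 : c <= 1.
  rewrite /c; case: (posnP #|Om|) => [->|O0]; first by rewrite mulr0 invr0 mulr0.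
  rewrite ler_pdivrMr ?mul1r; last by rewrite mulr_gt0 // ltr0n.
  by rewrite -natrM ler_nat; lia.
(* [M0] stays fixed, so every draw contributes the same factor [1 - c]. *)
elim: M => [|M IH] MM0 M0p.
  rewrite expr0 bin0 mul1r (big_pred1 set0) ?set0I ?cards0 ?expr0 // => E.
  by rewrite cards_eq0 /=; case: eqP => [->|]; rewrite ?sub0set ?andbF.
have M1 : 0 < M.+1%:R :> R by rewrite ltr0n.
rewrite -(ler_pM2l M1) sum_draws_succ.
rewrite mulrCA -natrM mul_bin_left natrM exprS -!mulrA.
apply: (@le_trans _ _ (\sum_(E : {set T} | (E \subset Om) && (#|E| == M))
     (2^-1 : R) ^+ #|E :&: P| * ((1 - c) * (#|Om| - M)%:R))); last first.
  rewrite -mulr_suml mulrC -mulrA ler_wpM2l ?subr_ge0 //.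
  rewrite mulrCA ler_wpM2l ?ler0n //; exact: IH (ltnW MM0) M0p.
apply: ler_sum => E /andP[EO /eqP cE].
have -> : \sum_(e in Om :\: E) (2^-1 : R) ^+ #|(e |: E) :&: P| =
    2^-1 ^+ #|E :&: P| * \sum_(e in Om :\: E) (1 - 2^-1 * (e \in P)%:R).
  rewrite mulr_sumr; apply: eq_bigr => e; rewrite inE => /andP[eE _].
  rewrite setIUl cardsU (_ : _ :&: (E :&: P) = set0); last first.
    apply/setP => x; rewrite !inE; case: eqP => //= ->.
    by rewrite (negbTE eE) ?andbF.
  rewrite cards0 subn0 exprD mulrC; congr (_ * _).
  case: (boolP (e \in P)) => eP.
    rewrite (setIidPl _) ?sub1set // cards1 expr1 mulr1; lra.
  rewrite (_ : _ :&: P = set0) ?cards0 ?expr0 ?mulr0 ?subr0 //.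
  by apply/setP => x; rewrite !inE; case: eqP => //= ->; rewrite (negbTE eP).
rewrite ler_wpM2l ?exprn_ge0 ?invr_ge0 //.
rewrite sumrB sumr_const -mulr_sumr -natr_sum cardsD (setIidPr EO) cE.
have -> : (\sum_(i in Om :\: E) (i \in P))%N = #|P :\: E|.
  rewrite -sum1_card big_mkcond [RHS]big_mkcond /=; apply: eq_bigr => e _.
  rewrite !inE; case: (boolP (e \in P)) => eP; last by rewrite andbF if_same.
  by rewrite (subsetP PO _ eP).
(* The elements drawn so far remove at most [M] elements of [P]. *)
have hP : (p - M0 <= #|P :\: E|)%N.
  rewrite cardsD; have : (#|P :&: E| <= M)%N by rewrite -cE subset_leq_card // subsetIr.
  lia.
rewrite -(ler_nat R) in hP.
have hO : c * (#|Om| - M)%:R <= c * #|Om|%:R by rewrite ler_wpM2l // ler_nat leq_subr.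
lra.
Qed.

(** Exponential Markov inequality: [2 ^+ L * 2^-1 ^+ #|E :&: P|] is at least 1 on the sets
    counted. *)
Lemma card_draws_tail (R : realFieldType) (T : finType) (Om P : {set T})
    (M p L : nat) :
  P \subset Om -> (p <= #|P|)%N -> (M <= p)%N ->
  #|[set E : {set T} | [&& E \subset Om, #|E| == M & (#|E :&: P| < L)%N]]|%:R
    <= 2 ^+ L * (1 - (p - M)%:R / (2 * #|Om|%:R)) ^+ M * 'C(#|Om|, M)%:R :> R.
Proof.
move=> PO pP Mp; rewrite -mulrA.
apply: le_trans (ler_wpM2l _ (@sum_draws_half R T Om P M M p PO pP _ Mp)) => //.
rewrite mulr_sumr -sum1_card natr_sum big_mkcond [leRHS]big_mkcond /=.
apply: ler_sum => E _; rewrite inE; case: ifP => [/and3P[-> -> h]|_] /=.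
  rewrite -[L](subnK (ltnW h)) exprD -mulrA exprVn mulfV ?expf_neq0 ?pnatr_eq0 //.
  by rewrite mulr1 exprn_ege1 // ler1n.
by case: ifP => // _; rewrite mulr_ge0 // exprn_ge0 // invr_ge0.
Qed.

Definition edge_dense (n d L : nat) (E : {set {set 'I_n}}) :=
  [forall S : {set 'I_n}, forall T : {set 'I_n},
    [==> [disjoint S & T], (d <= #|S|)%N, (d <= #|T|)%N =>
      (L <= #|@edges_between (graph_of_edges E) S T|)%N]].

Lemma card_edge_sets n M : #|edge_sets n M| = 'C('C(n, 2), M).
Proof.
rewrite -[n in 'C(n, 2)]card_ord -card_draws -cards_draws.
apply: eq_card => E; rewrite !inE; congr (_ && _).
by apply/forall_inP/subsetP => h e /h; rewrite inE.
Qed.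

(** Union bound over at most [4 ^ n] pairs [(S, T)], each spanning at least [d * d] potential
    edges. *)
Lemma card_not_edge_dense (R : realFieldType) (n M d L : nat) :
  (M <= d * d)%N -> (d * d <= 2 * 'C(n, 2))%N ->
  #|[set E in edge_sets n M | ~~ edge_dense d L E]|%:R
    <= 4 ^+ n * (2 ^+ L * (1 - (d * d - M)%:R / (2 * 'C(n, 2)%:R)) ^+ M
                 * #|edge_sets n M|%:R) :> R.
Proof.
move=> Md dn.
pose Om := [set e : {set 'I_n} | #|e| == 2].
have cOm : #|Om| = 'C(n, 2) by rewrite -[n in RHS]card_ord -card_draws.
pose Pr (ST : {set 'I_n} * {set 'I_n}) : {set {set 'I_n}} :=
  [set [set uv.1; uv.2] | uv in setX ST.1 ST.2].
pose ok (ST : {set 'I_n} * {set 'I_n}) :=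
  [&& [disjoint ST.1 & ST.2], (d <= #|ST.1|)%N & (d <= #|ST.2|)%N].
pose Bd ST := [set E : {set {set 'I_n}} |
  [&& E \subset Om, #|E| == M & (#|E :&: Pr ST| < L)%N]].
have sub : [set E in edge_sets n M | ~~ edge_dense d L E] \subset \bigcup_(ST | ok ST) Bd ST.
  apply/subsetP => E; rewrite inE => /andP[]; rewrite inE => /andP[/forall_inP E2 cE].
  rewrite negb_forall => /existsP[S]; rewrite negb_forall => /existsP[T].
  rewrite !negb_imply -ltnNge => /and4P[dST dS dT eL].
  apply/bigcupP; exists (S, T); first by rewrite /ok dST dS dT.
  rewrite inE cE; apply/and3P; split=> //.
    by apply/subsetP => e /E2; rewrite inE.
  apply: leq_ltn_trans eL.
  apply: leq_trans (leq_imset_card (fun uv => [set uv.1; uv.2]) _).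
  apply: subset_leq_card; apply/subsetP => e; rewrite inE => /andP[eE /imsetP[[u v] /=]].
  rewrite inE /= => /andP[uS vT] eE'; apply/imsetP; exists (u, v) => //.
  rewrite !inE /= uS vT /=; apply/andP; split; last by rewrite eE' in eE.
  apply: contraTneq dST => uv.
  by apply/pred0Pn; exists u; rewrite /= uS uv vT.
apply: (@le_trans _ _ (\sum_(ST | ok ST) #|Bd ST|%:R)).
  rewrite -natr_sum ler_nat (leq_trans (subset_leq_card sub)) //.
  exact: leq_card_bigcup.
set B := (X in 4 ^+ n * X).
have hB ST : ok ST -> #|Bd ST|%:R <= B.
  case: ST => S T /and3P[/= dST dS dT].
  (* As [S] and [T] are disjoint, an unordered pair determines which end lies in [S]. *)
  have inj : {in setX S T &, injective (fun uv : 'I_n * 'I_n => [set uv.1; uv.2])}.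
    move=> [u v] [u' v']; rewrite !inE /= => /andP[uS vT] /andP[u'S v'T] /setP e.
    have uT : u \notin T by apply: contraTN dST => uT; apply/pred0Pn; exists u; rewrite /= uS.
    have vS : v \notin S by apply: contraTN dST => vS; apply/pred0Pn; exists v; rewrite /= vT vS.
    have := e u; have := e v; rewrite !inE !eqxx orbT /=.
    case: (eqVneq v u') => [vu|_] /=; first by rewrite -vu (negbTE vS) in u'S.
    move=> /esym/eqP vv; rewrite -vv; case: (eqVneq u u') => [<- //|_] /=.
    by move=> /esym/eqP uv; rewrite uv vT in uT.
  have := @card_draws_tail R _ Om (Pr (S, T)) M (d * d) L _ _ Md.
  rewrite cOm /B card_edge_sets; apply.
    apply/subsetP => e /imsetP[[u v] /=]; rewrite !inE /= => /andP[uS vT] ->.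
    rewrite cards2; suff -> : u != v by [].
    by apply: contraTneq dST => uv; apply/pred0Pn; exists u; rewrite /= uS uv vT.
  by rewrite card_in_imset // cardsX leq_mul.
have B0 : 0 <= B.
  rewrite /B !mulr_ge0 ?exprn_ge0 // subr_ge0 -natrM.
  case: (posnP (2 * 'C(n, 2))) => [->|n0]; first by rewrite invr0 mulr0.
  by rewrite ler_pdivrMr ?ltr0n // mul1r ler_nat (leq_trans (leq_subr _ _)).
apply: (@le_trans _ _ (\sum_(ST : {set 'I_n} * {set 'I_n}) B)).
  rewrite [leRHS](bigID ok) /= -[leLHS]addr0; apply: lerD; first exact: ler_sum.
  by apply: sumr_ge0.
rewrite sumr_const card_prod !card_set_type card_ord -[leLHS]mulr_natl ler_wpM2r //.
by rewrite natrM natrX -exprMn -natrM.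
Qed.

(** * Parameters and numerical estimates *)

(** With [d = n %/ (3 * q)], the gap [n - m = n %/ q] is at least [3 * d], and [k = 3 * q] gives
    [n < k.+1 * d.+1], as the exclusion of the minor requires. *)
Lemma edge_dense_f_ell_ge (R : realType) (n q L : nat) (E : {set {set 'I_n}}) :
  (0 < q)%N -> (n %/ q < n)%N -> (0 < L)%N -> edge_dense (n %/ (3 * q)) L E ->
  let k := (3 * q)%N in let m := (n - n %/ q)%N in
  ((m ^ k) ^ n * (m ^ k) ^ n * 2 ^ n * 2 ^ n * q ^ m * (q ^ (k * k) - 1) ^ L
     < (q ^ (k * k)) ^ L)%N ->
  (((2 * m - m %/ q)%:R : R)%:E <= f_ell R (graph_of_edges E))%E.
Proof.
move=> q0 nq L0 dense k m num; set H := graph_of_edges E.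
have m0 : (0 < m)%N by rewrite subn_gt0.
set d := (n %/ (3 * q))%N in dense.
have HN (S T : {set H}) : [disjoint S & T] -> (d <= #|S|)%N -> (d <= #|T|)%N ->
    (L <= #|edges_between S T|)%N.
  move=> dST dS dT; move/forallP/(_ S)/forallP/(_ T): dense.
  by rewrite dST dS dT.
have cH : #|H| = n by rewrite card_ord.
have [|F [degF patF]] := @exists_nonedge_pattern H m q k d L q0 m0 HN.
  by rewrite cH.
apply: le_trans (ereal_sup_ubound _); last first.
  exists (pasted {ffun 'I_m -> 'I_(2 * m - 1)} F) => //.
  apply: (@pasted_minor_free H m k d) => //.
  - have : (d * 3 <= n %/ q)%N by rewrite /d (mulnC 3) divnMA leq_trunc_div.
    by rewrite cH /m; lia.
  - rewrite (@leq_ltn_trans n) ?leq_subr //.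
    rewrite (@leq_trans (d.+1 * k)%N) ?ltn_ceil ?muln_gt0 // mulnC leq_mul2r.
    by rewrite leqnSn orbT.
  - move=> S T dST dS dT; have := leq_trans L0 (HN S T dST dS dT).
    rewrite card_gt0 => /set0Pn[[u v]]; rewrite !inE /= => /andP[/andP[uS vT] uv].
    by exists u, v.
by rewrite lee_fin ler_nat list_chi_pasted.
Qed.

Lemma expR_lnM (R : realType) (n j : nat) : (0 < n)%N ->
  n%:R ^+ j = expR (j%:R * ln n%:R) :> R.
Proof. by move=> n0; rewrite expRM_natl lnK // posrE ltr0n. Qed.

Lemma exp2_le_expR (R : realType) (n : nat) : 2 ^+ n <= expR n%:R :> R.
Proof.
rewrite -[n%:R]mulr1 expRM_natl lerXn2r ?nnegrE ?expR_ge0 //.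
by have := expR_ge1Dx (1 : R); lra.
Qed.

(** The configurations number at most [expR ((2k + 1) n ln n + 2n)], while avoidance has probability
    at most [expR (- L / Q)]; [3 <= ln n] absorbs [2n] into one more [n ln n]. *)
Lemma pattern_count_lt (R : realType) (n m q k L : nat) :
  (0 < m)%N -> (m <= n)%N -> (0 < q)%N -> (q <= n)%N -> 3 <= ln n%:R :> R ->
  (q ^ (k * k))%:R * (2 * k%:R + 2) * n%:R * ln n%:R <= L%:R :> R ->
  ((m ^ k) ^ n * (m ^ k) ^ n * 2 ^ n * 2 ^ n * q ^ m * (q ^ (k * k) - 1) ^ L
     < (q ^ (k * k)) ^ L)%N.
Proof.
move=> m0 mn q0 qn ln3; set Q := (q ^ (k * k))%N => hL.
have Q0 : (0 < Q)%N by rewrite expn_gt0 q0.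
move: Q Q0 hL => Q Q0 hL.
have Q0R : 0 < Q%:R :> R by rewrite ltr0n.
have n0 : (0 < n)%N by apply: leq_trans mn.
have n0R : 0 < n%:R :> R by rewrite ltr0n.
set l : R := ln n%:R in ln3 hL.
have h1 : ((m ^ k) ^ n)%:R <= expR ((k * n)%:R * l) :> R.
  by rewrite -expR_lnM // -expnM natrX lerXn2r ?nnegrE // ler_nat.
have h2 : (2 ^ n)%:R <= expR n%:R :> R by rewrite natrX exp2_le_expR.
have h3 : (q ^ m)%:R <= expR (n%:R * l) :> R.
  rewrite -expR_lnM // natrX (@le_trans _ _ (n%:R ^+ m)) //.
    by rewrite lerXn2r ?nnegrE // ler_nat.
  by rewrite ler_weXn2l // ler1n.
have h4 : ((Q - 1) ^ L)%:R <= (Q ^ L)%:R * expR (- (L%:R / Q%:R)) :> R.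
  rewrite !natrX -mulrN expRM_natl -exprMn lerXn2r ?nnegrE ?mulr_ge0 ?expR_ge0 //.
  apply: (@le_trans _ _ (Q%:R * (1 - Q%:R^-1))); last first.
    by rewrite ler_wpM2l // expR_ge1Dx.
  by rewrite mulrDr mulr1 mulrN mulfV ?gt_eqF // natrB.
rewrite -(ltr_nat R) !natrM.
apply: (@le_lt_trans _ _ (expR ((k * n)%:R * l) * expR ((k * n)%:R * l) * expR n%:R *
   expR n%:R * expR (n%:R * l) * ((Q ^ L)%:R * expR (- (L%:R / Q%:R))))).
  by do ![apply: ler_pM => //; rewrite ?mulr_ge0 ?ler0n //].
rewrite mulrCA gtr_pMr ?ltr0n ?expn_gt0 ?Q0 // -!expRD expR_lt1.
have : (2 * k%:R + 2) * n%:R * l <= L%:R / Q%:R by rewrite ler_pdivlMr //; lra.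
rewrite natrM; have : 3 * n%:R <= n%:R * l by rewrite mulrC ler_wpM2l // ltW.
set a := L%:R / Q%:R; nra.
Qed.

Lemma mul2_bin2 n : (2 * 'C(n, 2) = n * n.-1)%N.
Proof.
rewrite mul2n bin2 -[RHS]odd_double_half oddM.
by case: n => // n /=; rewrite andNb.
Qed.

(** Here [d * d - M] is at least half of [d * d], and [2 * 'C(n, 2) <= n ^ 2]; then
    [1 - x <= expR (- x)]. *)
Lemma edge_dense_whp (R : realType) (n M d L : nat) :
  (2 * M <= d * d)%N -> (2 <= n)%N ->
  (d * d <= 2 * 'C(n, 2))%N ->
  1 - 4 ^+ n * (2 ^+ L * expR (- ((d * d)%:R / (2 * n%:R ^+ 2) * M%:R)))
   <= #|[set E in edge_sets n M | edge_dense d L E]|%:R / #|edge_sets n M|%:R :> R.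
Proof.
move=> Md n2 dC.
have cn := mul2_bin2 n.
have Mc : (M <= 'C(n, 2))%N by lia.
have N0 : 0 < #|edge_sets n M|%:R :> R by rewrite ltr0n card_edge_sets bin_gt0.
set X := (X in 1 - X).
have cs : #|edge_sets n M|%:R = #|[set E in edge_sets n M | ~~ edge_dense d L E]|%:R +
    #|[set E in edge_sets n M | edge_dense d L E]|%:R :> R.
  rewrite -natrD -(cardsID [set E | edge_dense d L E] (edge_sets n M)) addnC.
  by congr (_ + _)%:R; apply: eq_card => E; rewrite !inE // andbC.
rewrite ler_pdivlMr // mulrBl mul1r lerBlDl {1}cs lerD2r.
apply: le_trans (card_not_edge_dense R L _ dC) _; first by lia.
rewrite /X -!mulrA ler_wpM2l ?exprn_ge0 // ler_wpM2l ?exprn_ge0 // ler_wpM2r //.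
have C0 : 0 < 2 * 'C(n, 2)%:R :> R by rewrite -natrM ltr0n; lia.
rewrite (mulrA (d * d)%:R) -[- (_ * M%:R)]mulNr [_ * M%:R]mulrC expRM_natl lerXn2r ?nnegrE ?expR_ge0 //.
  rewrite subr_ge0 ler_pdivrMr // mul1r -natrM ler_nat; lia.
apply: le_trans (expR_ge1Dx _); rewrite lerD2l lerN2.
have n0 : 0 < 2 * n%:R ^+ 2 :> R by rewrite mulr_gt0 // exprn_gt0 // ltr0n; lia.
rewrite ler_pdivrMr // mulrAC ler_pdivlMr // -natrX -!natrM ler_nat cn.
have : (n * n.-1 <= n ^ 2)%N by rewrite -mulnn leq_mul2l leq_pred orbT.
nia.
Qed.

(** * Choice of the constant and passage to the limit *)

Lemma absz_ceil_bounds (R : realType) (x : R) : 0 <= x ->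
  x <= `|Num.ceil x|%N%:R < x + 1.
Proof.
move=> x0; have c0 : 0 <= Num.ceil x by rewrite ceil_ge0; lra.
rewrite natr_absz ger0_norm // ceil_ge /=.
by have := ceilB1_lt x; rewrite intrD; lra.
Qed.

(** Apply the sublinearity of [ln] to the square root of [x]. *)
Lemma ln_le_mul (R : realType) (a x : R) :
  0 < a -> 0 < x -> (2 / a) ^+ 2 <= x -> ln x <= a * x.
Proof.
move=> a0 x0 ax; set s := Num.sqrt x.
have s0 : 0 < s by rewrite sqrtr_gt0.
have xE : x = s ^+ 2 by rewrite sqr_sqrtr // ltW.
have as2 : 2 <= a * s.
  have : 2 / a <= s by move: ax; rewrite {1}xE ler_pXn2r // nnegrE ?divr_ge0 ?ltW.
  by rewrite ler_pdivrMr // mulrC.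
rewrite xE lnXn //; have := ln_sublinear s0; rewrite mulr2n expr2; nra.
Qed.

Lemma divn_bounds (n q : nat) : (2 <= q)%N -> (12 * q <= n)%N ->
  let d := (n %/ (3 * q))%N in
  [/\ (0 < n)%N, (n <= 6 * q * d)%N & (d * d <= n * n.-1)%N].
Proof.
move=> q2 qn d.
have dk : (d * (3 * q) <= n)%N by apply: leq_trunc_div.
have nd : (n < d.+1 * (3 * q))%N by apply: ltn_ceil; lia.
clearbody d; have d0 : (0 < d)%N by nia.
have d6 : (6 * d <= n)%N by nia.
by split; nia.
Qed.

(** With [m = n - x], the bound [2 * m - m %/ q] falls short of [2 * n] by at most [3 * n / q]. *)
Lemma divn_loss (n q : nat) : (2 <= q)%N -> (0 < n)%N ->
  let x := (n %/ q)%N in let y := ((n - x) %/ q)%N in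
  [/\ (2 * (n - x) - y = 2 * n - (2 * x + y))%N, (2 * x + y <= 2 * n)%N &
      ((2 * x + y) * q <= 3 * n)%N].
Proof.
move=> q2 n0 x y.
have xq : (x * q <= n)%N by apply: leq_trunc_div.
have yq : (y * q <= n - x)%N by apply: leq_trunc_div.
by clearbody y; clearbody x; split; nia.
Qed.

(** In [C], the factor [72 * q ^ 2] offsets the density [d ^ 2 / (2 * n ^ 2)]; the first summand is
    what [pattern_count_lt] asks of [L], and the 4 pays for [4 ^ n], rounding and the target
    [1 / n]. *)
Lemma gnm_prob_f_ell_ge (R : realType) (eps C : R) (q n : nat) :
  (2 <= q)%N -> 3 <= eps * q%:R ->
  C = ((q ^ (3 * q * (3 * q)))%:R * (2 * (3 * q)%:R + 2) + 4) * (72 * q%:R ^+ 2) ->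
  3 <= ln n%:R :> R -> (12 * q <= n)%N ->
  144 * q%:R ^+ 2 * C * ln n%:R <= n%:R ->
  1 - n%:R^-1 <= gnm_prob R n `|Num.ceil (C * n%:R * ln n%:R)|%N
       (fun H : sgraph => (((2 - eps) * n%:R)%:E <= f_ell R H)%E).
Proof.
move=> q2 q3 CE l3 qn lC.
have [n0 nd] := divn_bounds q2 qn; rewrite -mul2_bin2 => dC.
have [xy xy2 xyn] := divn_loss q2 n0.
have nq : (n %/ q < n)%N by rewrite ltn_Pdiv.
have q0 : (0 < q)%N by apply: ltnW.
have q_n : (q <= n)%N by apply: leq_trans qn; rewrite leq_pmull.
have n2 : (2 <= n)%N by apply: leq_trans q_n.
set k := (3 * q)%N in CE.
set C' : R := (q ^ (k * k))%:R * (2 * k%:R + 2) in CE; set l : R := ln n%:R in l3 lC *.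
have C'0 : 0 < C'.
  by rewrite /C' mulr_gt0 ?ltr0n ?expn_gt0 ?(ltnW q2) // ltr_wpDl // mulr_ge0.
set M := `|_|%N; pose L := `|Num.ceil (C' * n%:R * l)|%N; set d := (n %/ (3 * q))%N in nd dC.
have q0R : 0 < q%:R :> R by rewrite ltr0n.
have n0R : 0 < n%:R :> R by rewrite ltr0n.
have C0 : 0 < C by rewrite CE mulr_gt0 ?mulr_gt0 ?exprn_gt0 // addr_gt0.
have nl0 : 0 < n%:R * l by rewrite mulr_gt0 //; lra.
have /andP[M1 M2] : C * n%:R * l <= M%:R < C * n%:R * l + 1.
  by apply: absz_ceil_bounds; rewrite -mulrA ltW // mulr_gt0.
have /andP[L1 L2] : C' * n%:R * l <= L%:R < C' * n%:R * l + 1.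
  by apply: absz_ceil_bounds; rewrite -mulrA ltW // mulr_gt0.
have L0 : (0 < L)%N by rewrite -(ltr0n R) (lt_le_trans _ L1) // -mulrA mulr_gt0.
have nd2 : n%:R ^+ 2 <= 36 * q%:R ^+ 2 * (d * d)%:R :> R.
  rewrite -!natrX -!natrM ler_nat.
  by rewrite (@leq_trans ((6 * q * d) ^ 2)) ?leq_exp2r // !expnMn mulnn.
(* Both [144 * q ^ 2 * C * n * l] and the rounding term [144 * q ^ 2] are at most [n ^ 2], and
   [n <= 6 * q * d]. *)
have Md : (2 * M <= d * d)%N.
  rewrite -(ler_nat R) natrM -(@ler_pM2l _ (72 * q%:R ^+ 2)); last first.
    by rewrite mulr_gt0 // exprn_gt0.
  have qn2 : 144 * q%:R ^+ 2 <= n%:R ^+ 2 :> R.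
    by rewrite -!natrX -!natrM ler_nat (_ : 144 = 12 ^ 2)%N // -expnMn leq_exp2r.
  have lCn : 144 * q%:R ^+ 2 * (C * n%:R * l) <= n%:R ^+ 2.
    have := ler_wpM2r (ltW n0R) lC; rewrite expr2; lra.
  have : 144 * q%:R ^+ 2 * M%:R <= 144 * q%:R ^+ 2 * (C * n%:R * l + 1).
    by rewrite ler_wpM2l ?mulr_ge0 ?exprn_ge0 // ltW.
  lra.
have whp := @edge_dense_whp R n M d L Md n2 dC.
apply: (@le_trans _ _ (#|[set E in edge_sets n M | edge_dense d L E]|%:R
    / #|edge_sets n M|%:R)).
  apply: le_trans whp.
  rewrite lerD2l lerN2.
  have nV : n%:R^-1 = expR (- l) by rewrite expRN lnK // posrE.
  have e4 : 4 ^+ n <= expR (n%:R + n%:R) :> R.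
    rewrite (_ : 4 = 2 * 2 :> R) ?exprMn ?expRD; last by rewrite -natrM.
    by rewrite ler_pM ?exprn_ge0 ?exp2_le_expR.
  rewrite nV (@le_trans _ _ (expR (n%:R + n%:R) * (expR L%:R *
     expR (- ((d * d)%:R / (2 * n%:R ^+ 2) * M%:R))))) //.
    rewrite ler_pM ?mulr_ge0 ?exprn_ge0 ?expR_ge0 // ler_wpM2r ?expR_ge0 //.
    exact: exp2_le_expR.
  rewrite -!expRD ler_expR.
  have kap : (C' + 4) * n%:R * l <= (d * d)%:R / (2 * n%:R ^+ 2) * M%:R.
    apply: (@le_trans _ _ ((72 * q%:R ^+ 2)^-1 * (C * n%:R * l))).
      rewrite CE le_eqVlt; apply/orP; left; apply/eqP; field.
      by rewrite gt_eqF.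
    apply: ler_pM M1.
    - by rewrite invr_ge0 mulr_ge0 // exprn_ge0.
    - by rewrite -mulrA ltW // mulr_gt0.
    rewrite ler_pdivlMr; last by rewrite mulr_gt0 // exprn_gt0.
    rewrite mulrC ler_pdivrMr; last by rewrite mulr_gt0 // exprn_gt0.
    by move: nd2; clear; lra.
  have h3 : 3 * n%:R <= n%:R * l by rewrite mulrC ler_wpM2l // ltW.
  have n1 : 1 <= n%:R :> R by rewrite ler1n.
  have hl : l <= n%:R * l by rewrite ler_peMl // (le_trans _ l3).
  move: kap h3 hl L2 n1; clear; clearbody C'; clearbody l; lra.
rewrite /gnm_prob ler_wpM2r ?invr_ge0 // ler_nat subset_leq_card //.
apply/subsetP => E; rewrite !inE => /andP[-> dense]; apply/asboolP.
apply: le_trans (@edge_dense_f_ell_ge R n q L E _ _ L0 dense _); last 3 first.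
- exact: q0.
- exact: nq.
- apply: (@pattern_count_lt R) => //; rewrite ?subn_gt0 ?leq_subr //.
rewrite lee_fin xy natrB //.
move: xyn; rewrite -(ler_nat R) !natrM => xyn.
set z := (_ + _ %/ q)%N in xyn *.
have : z%:R <= eps * n%:R :> R.
  rewrite -(ler_pM2r q0R) (le_trans xyn) // mulrAC ler_wpM2r // ltW.
lra.
Qed.

Theorem theorem1p7 (R : realType) (eps : R) (eps_gt0 : 0 < eps) :
  exists C : R, 0 < C /\
    (gnm_prob R n `|Num.ceil (C * n%:R * ln n%:R)|%N
       (fun H : sgraph => (((2 - eps) * n%:R)%:E <= f_ell R H)%E)
     @[n --> \oo] --> (1 : R))%classic.
Proof.
(* One successor passes [3 / eps], the other ensures [2 <= q]. *)
pose q := (Num.truncn (3 / eps)).+2.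
have q3 : 3 <= eps * q%:R.
  rewrite mulrC -ler_pdivrMr // ltW // (lt_trans (truncnS_gt _)) //.
  by rewrite ltr_nat.
have q0 : 0 < q%:R :> R by rewrite ltr0n.
pose C : R := ((q ^ (3 * q * (3 * q)))%:R * (2 * (3 * q)%:R + 2) + 4) * (72 * q%:R ^+ 2).
have C0 : 0 < C.
  by rewrite mulr_gt0 ?mulr_gt0 ?exprn_gt0 // ltr_wpDl // mulr_ge0 // addr_ge0.
exists C; split=> //; apply/cvgrPdist_le => e e0.
pose a : R := (144 * q%:R ^+ 2 * C)^-1.
have a0 : 0 < a by rewrite invr_gt0 !mulr_gt0 // exprn_gt0.
near=> n.
have n12 : (12 * q <= n)%N.
  by rewrite -(ler_nat R); near: n; exact: nbhs_infty_ger.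
have n0 : 0 < n%:R :> R by rewrite ltr0n (leq_trans _ n12).
have l3 : 3 <= ln n%:R :> R.
  rewrite -ler_expR lnK ?posrE //; near: n; exact: nbhs_infty_ger.
have lC : 144 * q%:R ^+ 2 * C * ln n%:R <= n%:R.
  rewrite mulrC -ler_pdivlMr ?mulr_gt0 ?exprn_gt0 // -/a mulrC.
  by apply: ln_le_mul => //; near: n; exact: nbhs_infty_ger.
have ne : n%:R^-1 <= e.
  by rewrite -(invrK e) lef_pV2 ?posrE ?invr_gt0 //; near: n; exact: nbhs_infty_ger.
have := @gnm_prob_f_ell_ge R eps C q n isT q3 erefl l3 n12 lC.
set p := gnm_prob _ _ _ _ => p1.
(* With [p1], this puts [p] within [1 / n] of 1. *)
have p2 : p <= 1.
  rewrite /p /gnm_prob; set N := #|edge_sets _ _|.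
  have [->|N0] := posnP N; first by rewrite invr0 mulr0.
  rewrite ler_pdivrMr ?ltr0n // mul1r ler_nat subset_leq_card //.
  by apply/subsetP => E; rewrite inE => /andP[].
by rewrite ger0_norm ?subr_ge0 //; lra.
Unshelve. all: by end_near.
Qed.
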